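(* Let $f,g_{\mathcal A},g_{\mathcal B},h_{\mathcal A},h_{\mathcal B}$ be bounded real-valued functions on $\mathbb{R}$, let $\mathcal E_{\mathcal A},\mathcal E_{\mathcal B}\in\mathbb{C}^{I_1\times\cdots\times I_N\times I_1\times\cdots\times I_N}$ be Hermitian tensors with sets of eigenvalues $\mathrm{Sp}(\mathcal E_{\mathcal A})$ and $\mathrm{Sp}(\mathcal E_{\mathcal B})$, and let $m_{\mathcal A},n_{\mathcal A},k_{\mathcal A},m_{\mathcal B},n_{\mathcal B},k_{\mathcal B}$ be natural numbers. Define $$\psi(\lambda_{\mathcal A},\lambda_{\mathcal B})=\begin{cases}\dfrac{h_{\mathcal A}(\lambda_{\mathcal A}^{n_{\mathcal A}})}{g_{\mathcal A}(\lambda_{\mathcal A}^{m_{\mathcal A}})}\;\dfrac{f(\lambda_{\mathcal A}^{k_{\mathcal A}})-f(\lambda_{\mathcal B}^{k_{\mathcal B}})}{\lambda_{\mathcal A}^{k_{\mathcal A}}-\lambda_{\mathcal B}^{k_{\mathcal B}}}\;\dfrac{h_{\mathcal B}(\lambda_{\mathcal B}^{n_{\mathcal B}})}{g_{\mathcal B}(\lambda_{\mathcal B}^{m_{\mathcal B}})},&(\lambda_{\mathcal A},\lambda_{\mathcal B})\in\mathrm{Sp}(\mathcal E_{\mathcal A})\times\mathrm{Sp}(\mathcal E_{\mathcal B}),\\[2mm]0,&\text{otherwise,}\end{cases}$$ and set $$G_{\mathcal A}^{m_{\mathcal A}}=g_{\mathcal A}(\mathcal E_{\mathcal A}^{m_{\mathcal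 A}}),\quad G_{\mathcal B}^{m_{\mathcal B}}=g_{\mathcal B}(\mathcal E_{\mathcal B}^{m_{\mathcal B}}),\quad H_{\mathcal A}^{n_{\mathcal A}}=h_{\mathcal A}(\mathcal E_{\mathcal A}^{n_{\mathcal A}}),\quad H_{\mathcal B}^{n_{\mathcal B}}=h_{\mathcal B}(\mathcal E_{\mathcal B}^{n_{\mathcal B}}),\quad F_{\mathcal A}^{k_{\mathcal A}}=f(\mathcal E_{\mathcal A}^{k_{\mathcal A}}),\quad F_{\mathcal B}^{k_{\mathcal B}}=f(\mathcal E_{\mathcal B}^{k_{\mathcal B}}).$$ Then for $\mathcal X\in\mathbb{C}^{I_1\times\cdots\times I_N\times I_1\times\cdots\times I_N}$, $$H_{\mathcal A}^{n_{\mathcal A}}\star_N\left(F_{\mathcal A}^{k_{\mathcal A}}\star_N\mathcal X-\mathcal X\star_NF_{\mathcal B}^{k_{\mathcal B}}\right)\star_NH_{\mathcal B}^{n_{\mathcal B}}=T_\psi\left(G_{\mathcal A}^{m_{\mathcal A}}\star_N\left(\mathcal E_{\mathcal A}^{k_{\mathcal A}}\star_N\mathcal X-\mathcal X\star_N\mathcal E_{\mathcal B}^{k_{\mathcal B}}\right)\star_NG_{\mathcal B}^{m_{\mathcal B}}\right),$$ and in addition $$\left\|H_{\mathcal A}^{n_{\mathcal A}}\star_N\left(F_{\mathcal A}^{k_{\mathcal A}}\star_N\mathcal X-\mathcal X\star_NF_{\mathcal B}^{k_{\mathcal B}}\right)\star_NH_{\mathcal B}^{n_{\mathcal B}}\right\|\le\left(\mathbb{I}_1^N\right)^2\|\psi\|_\Psi\left\|G_{\mathcal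 A}^{m_{\mathcal A}}\star_N\left(\mathcal E_{\mathcal A}^{k_{\mathcal A}}\star_N\mathcal X-\mathcal X\star_N\mathcal E_{\mathcal B}^{k_{\mathcal B}}\right)\star_NG_{\mathcal B}^{m_{\mathcal B}}\right\| .$$
   Context: Tensors. $\mathbb{I}_1^N=I_1\cdots I_N$. For square tensors the Einstein product is $(\mathcal X\star_N\mathcal Y)_{i_1\ldots i_N,k_1\ldots k_N}=\sum_{j_1,\ldots,j_N}x_{i_1\ldots i_N,j_1\ldots j_N}y_{j_1\ldots j_N,k_1\ldots k_N}$; powers are with respect to $\star_N$. Every Hermitian tensor has an eigen-decomposition $\mathcal H=\sum_{i=1}^{\mathbb{I}_1^N}\lambda_i\mathcal P_i$ with real $\lambda_i$ and $\mathcal P_i=\mathcal U_i\star_1\mathcal U_i^H$, the $\mathcal U_i\in\mathbb{C}^{I_1\times\cdots\times I_N\times1}$ being orthonormal; $f(\mathcal H)=\sum_if(\lambda_i)\mathcal P_i$. $\|\cdot\|$ on tensors is the spectral norm (largest singular value). Class $\Psi$. $\Psi$ is the set of functions $\psi:\mathbb{R}\times\mathbb{R}\to\mathbb{C}$ with a representation $\psi(\lambda_{\mathcal A},\lambda_{\mathcal B})=\int_\Sigma f_{\mathcal A,\sigma}(\lambda_{\mathcal A})f_{\mathcal B,\sigma}(\lambda_{\mathcal B})\,d\mu(\sigma)$, where $(\Sigma,\mu)$ is a measure space and $f_{\mathcal A,\sigma},f_{\mathcal B,\sigma}:\mathbb{R}\to\mathbb{C}$ are bounded with $\int_\Sigma\|f_{\mathcal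 A,\sigma}\|_\infty\|f_{\mathcal B,\sigma}\|_\infty d\mu(\sigma)<\infty$ (the sum of two such representations being again of this form); $\|\psi\|_\Psi$ is the minimum (infimum) of $\int_\Sigma\|f_{\mathcal A,\sigma}\|_\infty\|f_{\mathcal B,\sigma}\|_\infty d\mu(\sigma)$ over all such representations. PDTI. With eigen-decompositions $\mathcal E_{\mathcal A}=\sum_i\lambda_{\mathcal A,i}\mathcal P_{\mathcal A,i}$, $\mathcal E_{\mathcal B}=\sum_j\lambda_{\mathcal B,j}\mathcal P_{\mathcal B,j}$, the parametrization double tensor integral is $$T_\psi(\mathcal X)=\int_\Sigma\Big(\sum_{i}f_{\mathcal A,\sigma}(\lambda_{\mathcal A,i})\mathcal P_{\mathcal A,i}\Big)\star_N\mathcal X\star_N\Big(\sum_{j}f_{\mathcal B,\sigma}(\lambda_{\mathcal B,j})\mathcal P_{\mathcal B,j}\Big)d\mu(\sigma).$$ Symbols such as $G_{\mathcal A}^{m_{\mathcal A}}$ are names of tensors, not powers. It is implicit in the formula for $\psi$ that $g_{\mathcal A}(\lambda_{\mathcal A}^{m_{\mathcal A}})$ and $g_{\mathcal B}(\lambda_{\mathcal B}^{m_{\mathcal B}})$ are nonzero on the respective spectra; at points with $\lambda_{\mathcal A}^{k_{\mathcal A}}=\lambda_{\mathcal B}^{k_{\mathcal B}}$ the difference quotient is given an arbitrary fixed finite value. *)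

(* Defs.v *)
From HB Require Import structures.
From mathcomp Require Import all_boot all_order all_algebra.
From mathcomp Require Import all_classical all_reals all_analysis.
From mathcomp Require Import complex.

Set Implicit Arguments.
Unset Strict Implicit.
Unset Printing Implicit Defensive.

Import Order.TTheory GRing.Theory Num.Theory.
Import numFieldNormedType.Exports.

Local Open Scope classical_set_scope.
Local Open Scope ring_scope.
Local Open Scope complex_scope.

(* Indices are counted from 0: the k-th component ranges over {0, ..., I k - 1}. *)
Definition mindex (N : nat) (I : 'I_N -> nat) : finType :=
  {dffun forall k : 'I_N, 'I_(I k)}.

Definition tensor (R : realType) (M N : nat) (I : 'I_M -> nat)
    (J : 'I_N -> nat) : Type :=
  {ffun mindex I * mindex J -> R[i]}.

(* The single trailing dimension 1 in C^(I_1 x ... x I_N x 1). *)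
Definition dim1 : 'I_1 -> nat := fun=> 1%N.

(* Total number of entries I_1 ... I_N of one multi-index. *)
Definition tdim (N : nat) (I : 'I_N -> nat) : nat := (\prod_(k < N) I k)%N.

Definition tmul (R : realType) (L M N : nat) (I : 'I_L -> nat)
    (J : 'I_M -> nat) (K : 'I_N -> nat)
    (X : tensor R I J) (Y : tensor R J K) : tensor R I K :=
  [ffun p => \sum_(j : mindex J) X (p.1, j) * Y (j, p.2)].

Notation "X *E Y" := (tmul X Y) (at level 40, left associativity).

Section Tensors.
Variable R : realType.

Definition thermT (M N : nat) (I : 'I_M -> nat) (J : 'I_N -> nat)
    (X : tensor R I J) : tensor R J I :=
  [ffun p => (X (p.2, p.1))^*].

Definition tscale (M N : nat) (I : 'I_M -> nat) (J : 'I_N -> nat) (c : R[i])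
    (X : tensor R I J) : tensor R I J :=
  [ffun p => c * X p].

Section Square.
Variables (N : nat) (I : 'I_N -> nat).

Definition tid : tensor R I I := [ffun p => (p.1 == p.2)%:R].

Definition tpow (X : tensor R I I) (m : nat) : tensor R I I :=
  iter m (tmul X) tid.

Definition hermitian_tensor (X : tensor R I I) : Prop := thermT X = X.

Definition teigenvalues (X : tensor R I I) : set R :=
  [set l | exists2 U : tensor R I dim1, U <> 0 & X *E U = tscale l%:C U].

Definition singular_values (X : tensor R I I) : set R :=
  [set s | 0 <= s /\ teigenvalues (thermT X *E X) (s ^+ 2)].

(* The set of singular values is finite, so that its supremum is its maximum. *)
Definition tnorm (X : tensor R I I) : R := sup (singular_values X).

Definition eigen_data : Type :=
  {ffun 'I_(tdim I) -> R} * {ffun 'I_(tdim I) -> tensor R I dim1}.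

Definition eigen_proj (e : eigen_data) (i : 'I_(tdim I)) : tensor R I I :=
  e.2 i *E thermT (e.2 i).

Definition orthonormal_family (U : 'I_(tdim I) -> tensor R I dim1) : Prop :=
  forall i j, thermT (U i) *E U j = [ffun=> (i == j)%:R].

Definition eigen_decomposition (H : tensor R I I) (e : eigen_data) : Prop :=
  orthonormal_family e.2 /\
  H = \sum_i tscale (e.1 i)%:C (eigen_proj e i).

Definition eigen_choice (H : tensor R I I) : eigen_data :=
  xget ([ffun=> 0], [ffun=> 0]) [set e | eigen_decomposition H e].

(* Meaningful for Hermitian H; see [hermitian_eigen_decomposition] and [tfunE]
   for the existence of a decomposition and the independence of the choice. *)
Definition tfun (f : R -> R[i]) (H : tensor R I I) : tensor R I I :=
  let e := eigen_choice H in
  \sum_i tscale (f (e.1 i)) (eigen_proj e i).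

Definition tfun_real (f : R -> R) (H : tensor R I I) : tensor R I I :=
  tfun (fun x => (f x)%:C) H.

End Square.

Definition bounded_real (f : R -> R) : Prop :=
  exists M : R, forall x, `|f x| <= M.

Definition bounded_complex (f : R -> R[i]) : Prop :=
  exists M : R, forall x, Normc.normc (f x) <= M.

Definition supnorm (f : R -> R[i]) : R := sup (range (fun x => Normc.normc (f x))).

Definition cmeasurable d (S : measurableType d) (f : S -> R[i]) : Prop :=
  measurable_fun setT (fun s => complex.Re (f s)) /\
  measurable_fun setT (fun s => complex.Im (f s)).

Definition cintegral d (S : measurableType d)
    (mu : {measure set S -> \bar R}) (f : S -> R[i]) : R[i] :=
  Rintegral mu setT (fun s => complex.Re (f s))
  +i* Rintegral mu setT (fun s => complex.Im (f s)).

(* Measurability in s is required only of the functions that are integrated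
   against mu. The s-integrand in [rep_eq] is bounded by the one in
   [rep_integrable], hence integrable. *)
Record Psi_rep (psi : R -> R -> R[i]) : Type := PsiRep {
  rep_display : measure_display;
  rep_space : measurableType rep_display;
  rep_mu : {measure set rep_space -> \bar R};
  rep_fA : rep_space -> R -> R[i];
  rep_fB : rep_space -> R -> R[i];
  rep_boundedA : forall s, bounded_complex (rep_fA s);
  rep_boundedB : forall s, bounded_complex (rep_fB s);
  rep_measurable : forall a b, cmeasurable (fun s => rep_fA s a * rep_fB s b);
  rep_integrable : rep_mu.-integrable setT
    (fun s => (supnorm (rep_fA s) * supnorm (rep_fB s))%:E);
  rep_eq : forall a b,
    psi a b = cintegral rep_mu (fun s => rep_fA s a * rep_fB s b) }.

Definition in_Psi (psi : R -> R -> R[i]) : Prop := inhabited (Psi_rep psi).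

Definition rep_cost (psi : R -> R -> R[i]) (r : Psi_rep psi) : \bar R :=
  (\int[rep_mu r]_(s in setT)
     (supnorm (rep_fA s) * supnorm (rep_fB s))%:E)%E.

(* +oo when psi has no representation. *)
Definition Psi_norm (psi : R -> R -> R[i]) : \bar R :=
  ereal_inf [set x | exists r : Psi_rep psi, rep_cost r = x].

Definition tintegral d (S : measurableType d)
    (mu : {measure set S -> \bar R}) (M N : nat) (I : 'I_M -> nat)
    (J : 'I_N -> nat) (F : S -> tensor R I J) : tensor R I J :=
  [ffun p => cintegral mu (fun s => F s p)].

Definition pdti (N : nat) (I : 'I_N -> nat) (EA EB : tensor R I I)
    (psi : R -> R -> R[i]) (r : Psi_rep psi) (X : tensor R I I) :
    tensor R I I :=
  tintegral (rep_mu r)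
    (fun s => tfun (rep_fA s) EA *E X *E tfun (rep_fB s) EB).

(* q supplies the values of the difference quotient where its denominator
   vanishes. *)
Definition diff_quotient (f : R -> R) (kA kB : nat) (q : R -> R -> R[i])
    (a b : R) : R[i] :=
  if a ^+ kA == b ^+ kB then q a b
  else ((f (a ^+ kA) - f (b ^+ kB)) / (a ^+ kA - b ^+ kB))%:C.

Definition psi_fun (f gA gB hA hB : R -> R) (mA nA kA mB nB kB : nat)
    (q : R -> R -> R[i]) (SA SB : set R) (a b : R) : R[i] :=
  if (a \in SA) && (b \in SB) then
    (hA (a ^+ nA) / gA (a ^+ mA))%:C * diff_quotient f kA kB q a b
      * (hB (b ^+ nB) / gB (b ^+ mB))%:C
  else 0.

End Tensors.

Section EigenFacts.
Variables (R : realType) (N : nat) (I : 'I_N -> nat).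

Lemma card_mindex : #|mindex I| = tdim I.
Proof.
rewrite card_dep_ffun /tdim foldrE big_map big_enum /=.
by apply: eq_bigr => k _; exact: card_ord.
Qed.

Let D := tdim I.
Let idx (a : 'I_D) : mindex I := enum_val (cast_ord (esym card_mindex) a).
Let rank (x : mindex I) : 'I_D := cast_ord card_mindex (enum_rank x).

Let rankK : cancel rank idx.
Proof. by move=> x; rewrite /idx /rank cast_ordK enum_rankK. Qed.
Let idxK : cancel idx rank.
Proof. by move=> a; rewrite /idx /rank enum_valK cast_ordKV. Qed.

Let z0 : mindex dim1 := [ffun=> ord0].
Let z0E (z : mindex dim1) : z = z0.
Proof.
by apply/(@ffunP 'I_1 (fun k => 'I_(dim1 k)) z z0) => k; rewrite ffunE; apply: (@ord1 (z k : 'I_1)).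
Qed.

Let sum_z (F : mindex dim1 -> R[i]) : \sum_z F z = F z0.
Proof.
by rewrite (bigD1 z0) //= big1 ?addr0 // => z; rewrite [z]z0E eqxx.
Qed.

Let sum_idx (F : mindex I -> R[i]) : \sum_x F x = \sum_(a < D) F (idx a).
Proof. by rewrite (reindex idx) //=; exists rank => x _. Qed.

Let toM (X : tensor R I I) : 'M[R[i]]_D := \matrix_(a, b) X (idx a, idx b).

Let toM_inj : injective toM.
Proof.
move=> X Y /matrixP e; apply/ffunP => -[x y].
by have := e (rank x) (rank y); rewrite !mxE !rankK.
Qed.

Let vecs (U : 'I_D -> tensor R I dim1) : 'M[R[i]]_D :=
  \matrix_(a, i) U i (idx a, z0).
Let adj (A : 'M[R[i]]_D) : 'M[R[i]]_D := map_mx (@conjc R) A^T.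

Let orthonormalE U :
  orthonormal_family U <-> adj (vecs U) *m vecs U = 1%:M.
Proof.
have E i j z z' : (thermT (U i) *E U j) (z, z') = (adj (vecs U) *m vecs U) i j.
  rewrite (z0E z) (z0E z') ffunE sum_idx !mxE; apply: eq_bigr => a _.
  by rewrite !mxE ffunE.
split=> [ou|ou i j].
  by apply/matrixP => i j; rewrite -(E i j z0 z0) ou ffunE !mxE.
by apply/ffunP => -[z z']; rewrite E ou ffunE !mxE.
Qed.

Let toM_sum (c : 'I_D -> R[i]) (U : 'I_D -> tensor R I dim1) :
  toM (\sum_i tscale (c i) (U i *E thermT (U i))) =
  vecs U *m diag_mx (\row_i c i) *m adj (vecs U).
Proof.
apply/matrixP => a b; rewrite !mxE sum_ffunE; apply: eq_bigr => i _.
rewrite ffunE ffunE sum_z ffunE /= mul_mx_diag !mxE.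
by rewrite mulrCA mulrA.
Qed.

Lemma eigen_decomposition_fun_unique (H : tensor R I I) (e e' : eigen_data R I)
    (f : R -> R[i]) :
  eigen_decomposition H e -> eigen_decomposition H e' ->
  \sum_i tscale (f (e.1 i)) (eigen_proj e i) =
  \sum_i tscale (f (e'.1 i)) (eigen_proj e' i).
Proof.
move=> [/orthonormalE oU HU] [/orthonormalE oV HV]; apply: toM_inj.
rewrite !(@toM_sum (fun i => f (_ i))).
have := congr1 toM HV; rewrite {1}HU !(@toM_sum (fun i => (_ i)%:C)).
set U := vecs e.2 in oU *; set V := vecs e'.2 in oV *.
set L := diag_mx _; set M := diag_mx _; set fL := diag_mx _.
set fM := (X in _ -> _ = V *m X *m _) => UV.
have oU' := mulmx1C oU; have oV' := mulmx1C oV.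
pose C := adj V *m U.
have CL : C *m L = M *m C.
  have := congr1 (fun Z => adj V *m Z *m U) UV.
  by rewrite !mulmxA oV mul1mx -!(mulmxA _ (adj U)) oU mulmx1.
have CfL : C *m fL = fM *m C.
  move: (C) CL => Z CL; apply/matrixP => j i.
  move/matrixP: CL => /(_ j i).
  rewrite !mul_mx_diag !mul_diag_mx !mxE => h.
  have [->|c0] := eqVneq (Z j i) 0; first by rewrite mul0r mulr0.
  suff -> : e.1 i = e'.1 j by rewrite mulrC.
  by move: h; rewrite mulrC => /(mulIf c0) [].
have -> : U *m fL *m adj U = V *m (C *m fL) *m adj U.
  by rewrite /C !mulmxA oV' mul1mx.
by rewrite CfL /C !mulmxA -(mulmxA _ U) oU' mulmx1.
Qed.

Lemma hermitian_eigen_decomposition (H : tensor R I I) :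
  hermitian_tensor H -> exists e, eigen_decomposition H e.
Proof.
move=> hH; pose A := toM H.
have hA : A \is hermsymmx.
  apply/is_hermitianmxP; rewrite expr0 scale1r.
  apply/matrixP => a b; rewrite !mxE -[in LHS]hH ffunE.
  by [].
have := hermitian_spectral_diag_real hA.
have := hermitian_normalmx hA => /orthomx_spectralP.
have /unitarymxP := spectral_unitarymx A.
rewrite invmx_unitary ?spectral_unitarymx //.
set P := spectralmx A; set sp := spectral_diag A => oP AE /mxOverP spr.
pose U : {ffun 'I_D -> tensor R I dim1} :=
  [ffun i => [ffun p => (P i (rank p.1))^*]].
pose l : {ffun 'I_D -> R} := [ffun i => complex.Re (sp 0 i)].
have vU : vecs U = map_mx (@conjc R) P^T.
  by apply/matrixP => a i; rewrite !mxE !ffunE /= idxK.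
have aU : adj (vecs U) = P.
  by apply/matrixP => a i; rewrite vU !mxE conjcK.
exists (l, U); split.
  by apply/orthonormalE; rewrite aU vU.
apply: toM_inj; rewrite (@toM_sum (fun i => (l i)%:C)) aU vU -/A {1}AE.
congr (_ *m diag_mx _ *m _); apply/matrixP => a i.
by rewrite (ord1 a) !mxE ffunE RRe_real.
Qed.

Lemma tfunE (f : R -> R[i]) (H : tensor R I I) (e : eigen_data R I) :
  eigen_decomposition H e ->
  tfun f H = \sum_i tscale (f (e.1 i)) (eigen_proj e i).
Proof.
move=> He; apply: (eigen_decomposition_fun_unique f _ He).
by apply: (@xgetPex _ _ [set e | eigen_decomposition H e]); exists e.
Qed.

End EigenFacts.

(* Main.v *)
Require Import Defs.
From mathcomp Require Import all_boot all_order all_algebra.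
From mathcomp Require Import all_classical all_reals all_analysis.
From mathcomp Require Import complex measurable_realfun ring.

(** Fix eigen-decompositions of [EA] and [EB] with unitary eigenvector matrices
    U and V, and describe a tensor X by the matrix U^H X V of its spectral
    coordinates. Functions of [EA] on the left and functions of [EB] on the
    right act diagonally there ([coord_sandwich]), and a double tensor integral
    acts as the Schur multiplier with entries psi (a_i, b_j): the integral is
    exchanged with the finite sums over the eigenvectors, and what is left under
    it is the representation of psi ([coord_pdti]). The identity becomes, entry
    by entry, the scalar identity [psi_fun_quotient], where the factor
    a^kA - b^kB of the argument cancels the denominator of the difference
    quotient; where that denominator vanishes both sides are 0, whatever value
    the quotient is given.

    The function psi lies in the class Psi because it vanishes off a finite
    grid: it is a finite sum of products, hence an integral against a sum of
    Dirac masses ([finite_support_in_Psi]).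

    For the norm bound, the Frobenius norm is invariant under passage to
    spectral coordinates, so a Schur multiplier increases it at most by the
    factor sup |psi|, and |psi (a, b)| is bounded by the cost of every
    representation, hence by the Psi-norm ([normc_le_Psi_norm]). The singular
    values compare the two norms: the square of the Frobenius norm is the sum
    of D = I_1 ... I_N squared singular values, so that
    ||X||^2 <= ||X||_F^2 <= D ||X||^2 ([tnorm_le_frobenius],
    [frobenius_le_tnorm]). Altogether the factor is sqrt D, which is at most
    D^2. *)

Set Implicit Arguments.
Unset Strict Implicit.
Unset Printing Implicit Defensive.

Import Order.TTheory GRing.Theory Num.Theory.

Local Open Scope ring_scope.
Local Open Scope complex_scope.

(** * Adjoints and the Frobenius norm of complex matrices *)

Definition adjmx (R : realType) m n (A : 'M[R[i]]_(m, n)) : 'M[R[i]]_(n, m) :=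
  map_mx (@conjc R) A^T.

Lemma adjmxK (R : realType) m n (A : 'M[R[i]]_(m, n)) : adjmx (adjmx A) = A.
Proof. by apply/matrixP => a b; rewrite !mxE conjcK. Qed.

Lemma adjmxM (R : realType) m n p (A : 'M[R[i]]_(m, n)) (B : 'M[R[i]]_(n, p)) :
  adjmx (A *m B) = adjmx B *m adjmx A.
Proof. by rewrite /adjmx trmx_mul map_mxM. Qed.

(** The equality m = n is a hypothesis because the eigenvectors are numbered by
    the product of the dimensions and their entries by the multi-indices: the
    two counts agree only propositionally. *)
Lemma isometry_square_unitary (R : realType) m n (V : 'M[R[i]]_(m, n)) :
  m = n -> adjmx V *m V = 1%:M -> V *m adjmx V = 1%:M.
Proof. by move=> mn; case: n / mn V => V; exact: mulmx1C. Qed.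

Definition frobenius2 (R : realType) m n (A : 'M[R[i]]_(m, n)) : R :=
  \sum_a \sum_b Normc.normc (A a b) ^+ 2.

Lemma normc2E (R : realType) (z : R[i]) :
  (Normc.normc z ^+ 2)%:C = conjc z * z.
Proof.
case: z => a b; rewrite /= sqr_sqrtr ?addr_ge0 ?sqr_ge0 //.
by apply/eqP; rewrite eq_complex /=; apply/andP; split; apply/eqP; ring.
Qed.

Lemma frobenius2E (R : realType) m n (A : 'M[R[i]]_(m, n)) :
  (frobenius2 A)%:C = \tr (adjmx A *m A).
Proof.
rewrite /mxtrace /frobenius2 exchange_big rmorph_sum; apply: eq_bigr => b _.
rewrite !mxE rmorph_sum; apply: eq_bigr => a _.
by rewrite !mxE /= normc2E.
Qed.

Lemma frobenius2_unitary (R : realType) m n p q (U : 'M[R[i]]_(m, n))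
    (A : 'M[R[i]]_(m, p)) (V : 'M[R[i]]_(p, q)) :
  U *m adjmx U = 1%:M -> V *m adjmx V = 1%:M ->
  frobenius2 (adjmx U *m A *m V) = frobenius2 A.
Proof.
move=> oU oV; apply: complexI; rewrite !frobenius2E !adjmxM adjmxK.
rewrite -mulmxA mxtrace_mulC !mulmxA -(mulmxA _ U) oU mulmx1.
by rewrite -(mulmxA _ V) oV mulmx1.
Qed.

(** * Tensors as matrices *)

Definition tensor_mx (R : realType) M N (I : 'I_M -> nat) (J : 'I_N -> nat)
    (X : tensor R I J) : 'M[R[i]]_(#|mindex I|, #|mindex J|) :=
  \matrix_(a, b) X (enum_val a, enum_val b).

Lemma tensor_mxM (R : realType) L M N (I : 'I_L -> nat) (J : 'I_M -> nat)
    (K : 'I_N -> nat) (X : tensor R I J) (Y : tensor R J K) :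
  tensor_mx (X *E Y) = tensor_mx X *m tensor_mx Y.
Proof.
apply/matrixP => a b; rewrite !mxE ffunE.
rewrite (reindex _ (onW_bij _ (enum_val_bij (mindex J)))) /=.
by apply: eq_bigr => j _; rewrite !mxE.
Qed.

Section TensorMatrix.
Variables (R : realType) (M N : nat) (I : 'I_M -> nat) (J : 'I_N -> nat).
Implicit Types X Y : tensor R I J.

Lemma tensor_mx_inj : injective (@tensor_mx R M N I J).
Proof.
move=> X Y /matrixP e; apply/ffunP => -[x y].
by have := e (enum_rank x) (enum_rank y); rewrite !mxE !enum_rankK.
Qed.

Lemma tensor_mxB X Y : tensor_mx (X - Y) = tensor_mx X - tensor_mx Y.
Proof. by apply/matrixP => a b; rewrite !mxE !ffunE. Qed.

Lemma tensor_mxZ c X : tensor_mx (tscale c X) = c *: tensor_mx X.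
Proof. by apply/matrixP => a b; rewrite !mxE !ffunE. Qed.

Lemma tensor_mx_sum (K : finType) (F : K -> tensor R I J) :
  tensor_mx (\sum_k F k) = \sum_k tensor_mx (F k).
Proof.
apply/matrixP => a b; rewrite mxE sum_ffunE summxE.
by apply: eq_bigr => k _; rewrite mxE.
Qed.

Lemma tensor_mx_adj X : tensor_mx (thermT X) = adjmx (tensor_mx X).
Proof. by apply/matrixP => a b; rewrite !mxE !ffunE. Qed.

End TensorMatrix.

Lemma tensor_mx_id (R : realType) N (I : 'I_N -> nat) :
  tensor_mx (tid R I) = 1%:M.
Proof.
by apply/matrixP => a b; rewrite !mxE !ffunE /= (inj_eq enum_val_inj).
Qed.

(** * Matrix form of eigen-decompositions *)

Lemma card_mindex_dim1 : #|mindex dim1| = 1%N.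
Proof. by rewrite card_mindex /tdim big_ord1. Qed.

Definition eigen_mx (R : realType) N (I : 'I_N -> nat) (e : eigen_data R I) :
    'M[R[i]]_(#|mindex I|, tdim I) :=
  \matrix_(a, i) tensor_mx (e.2 i) a (cast_ord (esym card_mindex_dim1) ord0).

Section EigenMatrix.
Variables (R : realType) (N : nat) (I : 'I_N -> nat).
Implicit Types (H X : tensor R I I) (e : eigen_data R I) (f : R -> R[i]).

Let ord1E (b : 'I_#|mindex dim1|) :
  b = cast_ord (esym card_mindex_dim1) ord0.
Proof.
by apply: val_inj; case: b => -[] //= b; rewrite {1}card_mindex_dim1.
Qed.

Let sum_dim1 (F : 'I_#|mindex dim1| -> R[i]) :
  \sum_b F b = F (cast_ord (esym card_mindex_dim1) ord0).
Proof.
rewrite (bigD1 (cast_ord (esym card_mindex_dim1) ord0)) //= big1 ?addr0 //.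
by move=> b; rewrite [b]ord1E eqxx.
Qed.

Lemma eigen_mx_isometry e :
  orthonormal_family e.2 -> adjmx (eigen_mx e) *m eigen_mx e = 1%:M.
Proof.
move=> oU; apply/matrixP => i j.
have /(congr1 (@tensor_mx _ _ _ _ _))/matrixP := oU i j.
set z := cast_ord (esym card_mindex_dim1) ord0; move=> /(_ z z).
rewrite tensor_mxM tensor_mx_adj !mxE ffunE => <-.
by apply: eq_bigr => a _; rewrite !mxE.
Qed.

Lemma eigen_mx_unitary e :
  orthonormal_family e.2 -> eigen_mx e *m adjmx (eigen_mx e) = 1%:M.
Proof.
by move/eigen_mx_isometry; apply: isometry_square_unitary; exact: card_mindex.
Qed.

Lemma tensor_mx_spectral e (c : 'I_(tdim I) -> R[i]) :
  tensor_mx (\sum_i tscale (c i) (eigen_proj e i)) =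
  eigen_mx e *m diag_mx (\row_i c i) *m adjmx (eigen_mx e).
Proof.
rewrite tensor_mx_sum; apply/matrixP => a b; rewrite summxE mxE.
apply: eq_bigr => i _.
rewrite tensor_mxZ tensor_mxM tensor_mx_adj mul_mx_diag !mxE sum_dim1 !mxE.
by rewrite mulrCA mulrA.
Qed.

Lemma tensor_mx_tfun e H f : eigen_decomposition H e ->
  tensor_mx (tfun f H) =
  eigen_mx e *m diag_mx (\row_i f (e.1 i)) *m adjmx (eigen_mx e).
Proof. by move=> /(tfunE f) ->; exact: tensor_mx_spectral. Qed.

Definition eigen_pow e (m : nat) : eigen_data R I :=
  ([ffun i => e.1 i ^+ m], e.2).

Lemma eigen_decomposition_pow e H m : eigen_decomposition H e ->
  eigen_decomposition (tpow H m) (eigen_pow e m).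
Proof.
move=> [oU HE]; split=> //; apply: tensor_mx_inj.
rewrite (@tensor_mx_spectral (eigen_pow e m) (fun i => (_ i)%:C)).
have -> : eigen_mx (eigen_pow e m) = eigen_mx e by [].
have UV := eigen_mx_isometry oU; have VU := eigen_mx_unitary oU.
elim: m => [|m IH].
  rewrite tensor_mx_id -VU; congr (_ *m _); rewrite -[LHS]mulmx1.
  congr (_ *m _); apply/matrixP => i j; rewrite !mxE ffunE expr0.
  by case: eqP => //= _; rewrite ?mulr0n ?mulr1n.
have -> : tpow H m.+1 = H *E tpow H m by [].
rewrite tensor_mxM IH [in LHS]HE.
rewrite (@tensor_mx_spectral e (fun i => (_ i)%:C)).
(* U D U^H U D^m U^H = U D^(m+1) U^H *)
rewrite !mulmxA -(mulmxA _ (adjmx _) (eigen_mx e)) UV mulmx1.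
rewrite -(mulmxA _ (diag_mx _) (diag_mx _)) mulmx_diag.
congr (_ *m diag_mx _ *m _); apply/matrixP => i j.
by rewrite !mxE !ffunE exprS rmorphM.
Qed.

Lemma tensor_mx_tfun_pow e H (g : R -> R) m : eigen_decomposition H e ->
  tensor_mx (tfun_real g (tpow H m)) =
  eigen_mx e *m diag_mx (\row_i (g (e.1 i ^+ m))%:C) *m adjmx (eigen_mx e).
Proof.
move=> /(eigen_decomposition_pow m)/tensor_mx_tfun ->.
by congr (_ *m diag_mx _ *m _); apply/matrixP => i j; rewrite !mxE ffunE.
Qed.

Lemma tensor_mx_pow e H m : eigen_decomposition H e ->
  tensor_mx (tpow H m) =
  eigen_mx e *m diag_mx (\row_i (e.1 i ^+ m)%:C) *m adjmx (eigen_mx e).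
Proof.
move=> /(eigen_decomposition_pow m)[_ ->].
rewrite (@tensor_mx_spectral _ (fun i => (_ i)%:C)).
by congr (_ *m diag_mx _ *m _); apply/matrixP => i j; rewrite !mxE ffunE.
Qed.

(** In the coordinates w = U^H u an eigenvector equation reads a_i w_i = l w_i,
    and a nonzero w has a nonzero coordinate, which forces l = a_i. *)
Lemma teigenvaluesP e H l : eigen_decomposition H e ->
  teigenvalues H l <-> exists i, l = e.1 i.
Proof.
move=> [oU HE].
have UV := eigen_mx_isometry oU; have VU := eigen_mx_unitary oU.
have HM : tensor_mx H =
    eigen_mx e *m diag_mx (\row_i (e.1 i)%:C) *m adjmx (eigen_mx e).
  by rewrite [in LHS]HE (@tensor_mx_spectral e (fun i => (_ i)%:C)).
split=> [[u u0]|[i ->]].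
  move=> /(congr1 (@tensor_mx _ _ _ _ _)); rewrite tensor_mxM tensor_mxZ HM.
  move=> /(congr1 (mulmx (adjmx (eigen_mx e)))).
  rewrite !mulmxA UV mul1mx -scalemxAr -mulmxA.
  set v := _ *m tensor_mx u => ve.
  have v0 : v != 0.
    apply/eqP => v0; apply: u0; apply: tensor_mx_inj.
    rewrite -[LHS]mul1mx -VU -mulmxA -/v v0 mulmx0.
    by apply/matrixP => a b; rewrite !mxE ffunE.
  clearbody v.
  have [i [b vib]] : exists i b, v i b != 0.
    apply: contrapT => /forallNP vE; move/eqP: v0; apply; apply/matrixP => i b.
    rewrite [RHS]mxE; have [//|vib] := eqVneq (v i b) 0.
    by case: (vE i); exists b.
  exists i; move/matrixP: ve => /(_ i b).
  by rewrite mul_diag_mx !mxE => /(mulIf vib)[].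
exists (e.2 i).
  move=> u0; have /matrixP/(_ i i) := UV; rewrite !mxE eqxx big1.
    by move/eqP; rewrite eq_sym oner_eq0.
  by move=> a _; rewrite !mxE u0 ffunE mulr0.
apply: tensor_mx_inj; rewrite tensor_mxM tensor_mxZ HM.
(* The i-th eigenvector is the eigenvector matrix times the i-th unit vector. *)
have uE : tensor_mx (e.2 i) = eigen_mx e *m \matrix_(k, b) (k == i)%:R.
  apply/matrixP => a b; rewrite [RHS]mxE (bigD1 i) //= big1 ?addr0.
    by rewrite !mxE eqxx mulr1 [b in LHS]ord1E.
  by move=> k /negPf ki; rewrite !mxE ki mulr0.
rewrite uE !mulmxA -(mulmxA _ (adjmx _)) UV mulmx1 scalemxAr -mulmxA.
congr (_ *m _); apply/matrixP => k b; rewrite mul_diag_mx !mxE.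
by case: eqP => [->|_]; rewrite ?mulr0.
Qed.

(** * Spectral coordinates *)

Definition spectral_coord (e e' : eigen_data R I) (X : tensor R I I) :
    'M[R[i]]_(tdim I) :=
  adjmx (eigen_mx e) *m tensor_mx X *m eigen_mx e'.

Section Coordinates.
Variables (EA EB : tensor R I I) (eA eB : eigen_data R I).
Hypothesis eAP : eigen_decomposition EA eA.
Hypothesis eBP : eigen_decomposition EB eB.
Local Notation coord := (spectral_coord eA eB).

Lemma tensor_mx_coord X :
  tensor_mx X = eigen_mx eA *m coord X *m adjmx (eigen_mx eB).
Proof.
rewrite /spectral_coord !mulmxA (eigen_mx_unitary eAP.1) mul1mx.
by rewrite -mulmxA (eigen_mx_unitary eBP.1) mulmx1.
Qed.

Lemma spectral_coord_inj : injective coord.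
Proof.
move=> X Y XY; apply: tensor_mx_inj.
by rewrite (tensor_mx_coord X) XY -tensor_mx_coord.
Qed.

Lemma spectral_coordB X Y : coord (X - Y) = coord X - coord Y.
Proof. by rewrite /spectral_coord tensor_mxB mulmxBr mulmxBl. Qed.

Lemma spectral_coord_mull (Z : tensor R I I) (c : 'I_(tdim I) -> R[i]) X :
  tensor_mx Z = eigen_mx eA *m diag_mx (\row_i c i) *m adjmx (eigen_mx eA) ->
  forall i j, coord (Z *E X) i j = c i * coord X i j.
Proof.
move=> ZE i j; rewrite /spectral_coord tensor_mxM ZE !mulmxA.
by rewrite (eigen_mx_isometry eAP.1) mul1mx -!mulmxA mul_diag_mx !mxE.
Qed.

Lemma spectral_coord_mulr (Z : tensor R I I) (c : 'I_(tdim I) -> R[i]) X :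
  tensor_mx Z = eigen_mx eB *m diag_mx (\row_i c i) *m adjmx (eigen_mx eB) ->
  forall i j, coord (X *E Z) i j = coord X i j * c j.
Proof.
move=> ZE i j; rewrite /spectral_coord tensor_mxM ZE -!mulmxA.
rewrite (eigen_mx_isometry eBP.1) mulmx1 !mulmxA mul_mx_diag.
by rewrite [LHS]mxE; congr (_ * _); rewrite mxE.
Qed.

(** The estimate of a Schur multiplier is made in spectral coordinates; this
    brings it back to the tensors. *)
Lemma frobenius2_coord X : frobenius2 (coord X) = frobenius2 (tensor_mx X).
Proof.
apply: frobenius2_unitary; apply: eigen_mx_unitary.
  exact: eAP.1.
exact: eBP.1.
Qed.

End Coordinates.
End EigenMatrix.

(** * Spectral norm against Frobenius norm *)

Section SpectralNorm.
Variables (R : realType) (N : nat) (I : 'I_N -> nat).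
Implicit Types (X : tensor R I I) (e : eigen_data R I).

Lemma gram_hermitian X : hermitian_tensor (thermT X *E X).
Proof.
apply: tensor_mx_inj.
by rewrite tensor_mx_adj tensor_mxM tensor_mx_adj adjmxM adjmxK.
Qed.

(** The i-th eigenvalue of X^H X is the squared norm of X u_i, since the columns
    of X U have the diagonal Gram matrix U^H X^H X U. *)
Lemma gram_eigenvalue_ge0 X e i :
  eigen_decomposition (thermT X *E X) e -> 0 <= e.1 i.
Proof.
move=> eP; have UV := eigen_mx_isometry eP.1.
have /matrixP/(_ i i) : adjmx (tensor_mx X *m eigen_mx e) *m
    (tensor_mx X *m eigen_mx e) = diag_mx (\row_i (e.1 i)%:C).
  rewrite adjmxM mulmxA -(mulmxA _ (adjmx _)) -tensor_mx_adj -tensor_mxM eP.2.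
  rewrite (@tensor_mx_spectral _ _ _ e (fun i => (_ i)%:C)).
  by rewrite !mulmxA UV mul1mx -mulmxA UV mulmx1.
rewrite mxE [RHS]mxE eqxx mulr1n [RHS]mxE => diagE.
rewrite -lecR -diagE sumr_ge0 // => a _.
by rewrite mxE mxE -normc2E lecR sqr_ge0.
Qed.

(** Both sides are the trace of X^H X. *)
Lemma sum_gram_eigenvalues X e : eigen_decomposition (thermT X *E X) e ->
  \sum_i e.1 i = frobenius2 (tensor_mx X).
Proof.
move=> eP; apply: complexI; rewrite frobenius2E -tensor_mx_adj -tensor_mxM eP.2.
rewrite (@tensor_mx_spectral _ _ _ e (fun i => (_ i)%:C)).
rewrite -mulmxA mxtrace_mulC -mulmxA (eigen_mx_isometry eP.1) mulmx1.
by rewrite mxtrace_diag rmorph_sum; apply: eq_bigr => i _; rewrite mxE.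
Qed.

Lemma singular_values_le_frobenius X s :
  singular_values X s -> s ^+ 2 <= frobenius2 (tensor_mx X).
Proof.
have [e eP] := hermitian_eigen_decomposition (gram_hermitian X).
move=> [s0 /(teigenvaluesP _ eP)[i ->]].
rewrite -(sum_gram_eigenvalues eP) (bigD1 i) //= lerDl sumr_ge0 // => j _.
exact: gram_eigenvalue_ge0 eP.
Qed.

Lemma frobenius2_ge0 m n (A : 'M[R[i]]_(m, n)) : 0 <= frobenius2 A.
Proof. by apply: sumr_ge0 => a _; apply: sumr_ge0 => b _; exact: sqr_ge0. Qed.

Lemma singular_values_ubound X :
  ubound (singular_values X) (Num.sqrt (frobenius2 (tensor_mx X))).
Proof.
move=> s sX; rewrite -[s](ger0_norm sX.1) -sqrtr_sqr.
by apply: ler_wsqrtr; exact: singular_values_le_frobenius.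
Qed.

(** When some dimension is 0 there are no singular values, and the norm is the
    supremum of the empty set, which is 0. *)
Lemma tnorm_ge0 X : 0 <= tnorm X.
Proof.
rewrite /tnorm.
have [[s sX]|/forallNP/= no] := pselect (exists s, singular_values X s).
  apply: le_trans sX.1 _; apply: ub_le_sup => //.
  exists (Num.sqrt (frobenius2 (tensor_mx X))).
  exact: singular_values_ubound.
rewrite (_ : singular_values X = set0) ?sup0 //.
by apply/seteqP; split=> // s /no.
Qed.

Lemma tnorm_le_frobenius X : tnorm X ^+ 2 <= frobenius2 (tensor_mx X).
Proof.
rewrite -[leRHS]sqr_sqrtr ?frobenius2_ge0 // ler_sqr ?nnegrE ?tnorm_ge0 //.
rewrite /tnorm.
have [sX|/forallNP/= no] := pselect (exists s, singular_values X s).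
  by apply: ge_sup => //; exact: singular_values_ubound.
rewrite (_ : singular_values X = set0) ?sup0 ?sqrtr_ge0 //.
by apply/seteqP; split=> // s /no.
Qed.

Lemma frobenius_le_tnorm X :
  frobenius2 (tensor_mx X) <= (tdim I)%:R * tnorm X ^+ 2.
Proof.
have [e eP] := hermitian_eigen_decomposition (gram_hermitian X).
rewrite -(sum_gram_eigenvalues eP) -[X in X%:R * _]card_ord mulr_natl.
rewrite -sumr_const; apply: ler_sum => i _.
have ei0 := gram_eigenvalue_ge0 i eP.
rewrite -[leLHS]sqr_sqrtr // ler_sqr ?nnegrE ?sqrtr_ge0 ?tnorm_ge0 //.
apply: ub_le_sup.
  exists (Num.sqrt (frobenius2 (tensor_mx X))).
  exact: singular_values_ubound.
split; first exact: sqrtr_ge0.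
by rewrite sqr_sqrtr //; apply/(teigenvaluesP _ eP); exists i.
Qed.

End SpectralNorm.

(** * Integrals of complex-valued functions *)

Lemma normc_ge0 (R : realType) (z : R[i]) : 0 <= Normc.normc z.
Proof. by case: z => x y; exact: sqrtr_ge0. Qed.

Lemma normc_conj (R : realType) (z : R[i]) :
  Normc.normc (conjc z) = Normc.normc z.
Proof. by case: z => x y /=; rewrite sqrrN. Qed.

Lemma Re_le_normc (R : realType) (z : R[i]) : `|complex.Re z| <= Normc.normc z.
Proof. by case: z => x y; rewrite -sqrtr_sqr ler_wsqrtr // lerDl sqr_ge0. Qed.

Lemma Im_le_normc (R : realType) (z : R[i]) : `|complex.Im z| <= Normc.normc z.
Proof. by case: z => x y; rewrite -sqrtr_sqr ler_wsqrtr // lerDr sqr_ge0. Qed.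

Section ComplexIntegral.
Variables (R : realType) (d : measure_display) (S : measurableType d).
Variable mu : {measure set S -> \bar R}.
Implicit Types (h : S -> R[i]) (c : R[i]) (w : S -> R).

Definition cintegrable h : Prop :=
  mu.-integrable setT (EFin \o (fun s => complex.Re (h s))) /\
  mu.-integrable setT (EFin \o (fun s => complex.Im (h s))).

Let ReD (x y : R[i]) : complex.Re (x + y) = complex.Re x + complex.Re y.
Proof. by case: x; case: y. Qed.
Let ImD (x y : R[i]) : complex.Im (x + y) = complex.Im x + complex.Im y.
Proof. by case: x; case: y. Qed.
Let ReM (x y : R[i]) : complex.Re (x * y) =
  complex.Re x * complex.Re y - complex.Im x * complex.Im y.
Proof. by case: x; case: y. Qed.
Let ImM (x y : R[i]) : complex.Im (x * y) =
  complex.Re x * complex.Im y + complex.Im x * complex.Re y.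
Proof. by case: x; case: y. Qed.

Let integrableMl (r : R) (u : S -> R) : mu.-integrable setT (EFin \o u) ->
  mu.-integrable setT (EFin \o (fun s => r * u s)).
Proof. by move=> iu; apply: eq_integrable (integrableZl _ r iu). Qed.

Lemma cintegrableD h1 h2 : cintegrable h1 -> cintegrable h2 ->
  cintegrable (fun s => h1 s + h2 s).
Proof.
move=> [r1 i1] [r2 i2]; split.
  by apply: eq_integrable (integrableD _ r1 r2) => // s _ /=; rewrite ReD EFinD.
by apply: eq_integrable (integrableD _ i1 i2) => // s _ /=; rewrite ImD EFinD.
Qed.

Lemma cintegrableZ c h : cintegrable h -> cintegrable (fun s => c * h s).
Proof.
move=> [rh ih]; split.
  apply: eq_integrable (integrableB _ (integrableMl (complex.Re c) rh)
    (integrableMl (complex.Im c) ih)) => // s _ /=.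
  by rewrite ReM EFinB.
apply: eq_integrable (integrableD _ (integrableMl (complex.Re c) ih)
  (integrableMl (complex.Im c) rh)) => // s _ /=.
by rewrite ImM EFinD.
Qed.

Lemma cintegralD h1 h2 : cintegrable h1 -> cintegrable h2 ->
  cintegral mu (fun s => h1 s + h2 s) = cintegral mu h1 + cintegral mu h2.
Proof.
move=> [r1 i1] [r2 i2]; apply/eqP; rewrite eq_complex /=.
under eq_Rintegral do rewrite ReD.
rewrite RintegralD // eqxx /=; apply/eqP.
by under eq_Rintegral do rewrite ImD; rewrite RintegralD.
Qed.

Lemma cintegralZ c h : cintegrable h ->
  cintegral mu (fun s => c * h s) = c * cintegral mu h.
Proof.
move=> [rh ih]; apply/eqP; rewrite eq_complex; apply/andP; split; apply/eqP.
  rewrite ReM /=; under eq_Rintegral do rewrite ReM.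
  by rewrite RintegralB ?RintegralZl //; exact: integrableMl.
rewrite ImM /=; under eq_Rintegral do rewrite ImM.
by rewrite RintegralD ?RintegralZl //; exact: integrableMl.
Qed.

Lemma cintegral_sum (K : finType) (c : K -> R[i]) (h : K -> S -> R[i]) :
  (forall k, cintegrable (h k)) ->
  cintegral mu (fun s => \sum_k c k * h k s) = \sum_k c k * cintegral mu (h k).
Proof.
move=> ih.
suff [] : cintegrable (fun s => \sum_k c k * h k s) /\
  cintegral mu (fun s => \sum_k c k * h k s) =
  \sum_k c k * cintegral mu (h k) by [].
elim: (index_enum K) => [|k r [ir IH]].
  have -> : (fun s => \sum_(k <- [::]) c k * h k s) = fun=> 0.
    by apply/funext => s; rewrite big_nil.
  rewrite big_nil; split; first by split; exact: integrable0.
  by rewrite /cintegral /= Rintegral_cst // mul0r.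
have -> : (fun s => \sum_(k0 <- k :: r) c k0 * h k0 s) =
    fun s => c k * h k s + \sum_(k0 <- r) c k0 * h k0 s.
  by apply/funext => s; rewrite big_cons.
have ik := cintegrableZ (c k) (ih k).
rewrite big_cons; split; first exact: cintegrableD.
by rewrite cintegralD // cintegralZ // IH.
Qed.

Lemma cintegrable_dominated h w : cmeasurable h ->
  mu.-integrable setT (EFin \o w) -> (forall s, Normc.normc (h s) <= w s) ->
  cintegrable h.
Proof.
move=> [mr mi] iw hw.
split; apply: le_integrable iw => //; try exact/measurable_EFinP.
  move=> s _ /=; rewrite lee_fin; apply: le_trans (ler_norm _).
  exact: le_trans (Re_le_normc _) (hw s).
move=> s _ /=; rewrite lee_fin; apply: le_trans (ler_norm _).
exact: le_trans (Im_le_normc _) (hw s).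
Qed.

(** The modulus inequality with the sharp constant 1; bounding real and
    imaginary parts apart would lose a factor sqrt 2. With z the integral and
    n its modulus, n^2 = Re (z^* z) is the integral of Re (z^* h), and
    Re (z^* h) <= n |h|. *)
Lemma normc_cintegral_le h w : cmeasurable h ->
  mu.-integrable setT (EFin \o w) -> (forall s, Normc.normc (h s) <= w s) ->
  Normc.normc (cintegral mu h) <= Rintegral mu setT w.
Proof.
move=> mh iw hw; have ih := cintegrable_dominated mh iw hw.
have [irh iih] := ih.
set z := cintegral mu h; set n := Normc.normc z.
have n0 : 0 <= n := normc_ge0 z.
have [n1|n1] := eqVneq n 0.
  rewrite n1; apply: Rintegral_ge0 => s _; apply: le_trans (hw s).
  exact: normc_ge0.
have npos : 0 < n by rewrite lt_def n1.
rewrite -(ler_pM2l npos) -expr2.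
have -> : n ^+ 2 = complex.Re (cintegral mu (fun s => conjc z * h s)).
  by rewrite cintegralZ // -normc2E.
rewrite /cintegral /= -RintegralZl //.
have [iz _] := cintegrableZ (conjc z) ih.
apply: le_Rintegral => //; first exact: integrableMl.
move=> s _; apply: le_trans (_ : n * Normc.normc (h s) <= _); last first.
  by rewrite ler_wpM2l.
rewrite /n -normc_conj -Normc.normcM.
exact: le_trans (ler_norm _) (Re_le_normc _).
Qed.

End ComplexIntegral.

(** * Representations of functions in the class Psi *)

Lemma normc_le_supnorm (R : realType) (f : R -> R[i]) (x : R) :
  bounded_complex f -> Normc.normc (f x) <= supnorm f.
Proof.
move=> [M fM]; apply: ub_le_sup; last by exists x.
by exists M => _ [y _ <-].
Qed.

Section Representation.
Variables (R : realType) (psi : R -> R -> R[i]) (r : Psi_rep psi).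

Lemma rep_dominated a b s :
  Normc.normc (@rep_fA _ _ r s a * @rep_fB _ _ r s b) <=
  supnorm (@rep_fA _ _ r s) * supnorm (@rep_fB _ _ r s).
Proof.
rewrite Normc.normcM ler_pM ?normc_ge0 //; apply: normc_le_supnorm.
  exact: rep_boundedA.
exact: rep_boundedB.
Qed.

Lemma rep_cintegrable a b :
  cintegrable (rep_mu r) (fun s => @rep_fA _ _ r s a * @rep_fB _ _ r s b).
Proof.
apply: cintegrable_dominated (rep_integrable r) (rep_dominated a b).
exact: rep_measurable.
Qed.

Lemma normc_le_rep_cost a b : ((Normc.normc (psi a b))%:E <= rep_cost r)%E.
Proof.
rewrite (rep_eq r) /rep_cost -[leRHS]fineK.
  rewrite lee_fin.
  apply: normc_cintegral_le (rep_integrable r) (rep_dominated a b).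
  exact: rep_measurable.
exact: integrable_fin_num (rep_integrable r).
Qed.

Lemma rep_cost_fin_num : rep_cost r \is a fin_num.
Proof. exact: integrable_fin_num (rep_integrable r). Qed.

End Representation.

Lemma normc_le_Psi_norm (R : realType) (psi : R -> R -> R[i]) a b :
  ((Normc.normc (psi a b))%:E <= Psi_norm psi)%E.
Proof. by apply: le_ereal_inf_tmp => _ [r <-]; exact: normc_le_rep_cost. Qed.

Lemma Psi_norm_fin_num (R : realType) (psi : R -> R -> R[i]) :
  in_Psi psi -> Psi_norm psi \is a fin_num.
Proof.
move=> [r]; rewrite fin_numElt; apply/andP; split.
  by apply: lt_le_trans (normc_le_Psi_norm psi 0 0); rewrite ltNyr.
apply: le_lt_trans (_ : rep_cost r < +oo)%E.
  by apply: ereal_inf_lbound; exists r.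
by rewrite ltey_eq rep_cost_fin_num.
Qed.

(** * Finitely supported functions belong to Psi *)

Section Discrete.
Variables (R : realType) (n : nat).

Definition dirac_sum : {measure set nat -> \bar R} :=
  msum (fun k => \d_k : {measure set nat -> \bar R}) n.

Lemma ge0_integral_dirac_sum (u : nat -> R) : (forall k, 0 <= u k) ->
  (\int[dirac_sum]_k (u k)%:E = (\sum_(k < n) u k)%:E)%E.
Proof.
move=> u0; rewrite ge0_integral_measure_sum //; last first.
  by move=> k _; rewrite lee_fin.
rewrite -sumEFin; apply: eq_bigr => k _.
by rewrite integral_dirac // diracT mul1e.
Qed.

Lemma integrable_dirac_sum (u : nat -> R) :
  dirac_sum.-integrable setT (EFin \o u).
Proof.
apply/integrableP; split=> //.
by rewrite (ge0_integral_dirac_sum (u := fun k => `|u k|)) // ltry.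
Qed.

(** A real function is the difference of the nonnegative functions u + |u| and
    |u|, so the nonnegative case suffices. *)
Lemma Rintegral_dirac_sum (u : nat -> R) :
  Rintegral dirac_sum setT u = \sum_(k < n) u k.
Proof.
transitivity (Rintegral dirac_sum setT (fun k => (u k + `|u k|) - `|u k|)).
  by apply: eq_Rintegral => k _; rewrite addrK.
rewrite RintegralB //; try exact: integrable_dirac_sum.
rewrite /Rintegral !ge0_integral_dirac_sum //=; last first.
  by move=> k; rewrite -lerBlDr sub0r lerNl ler_normr lexx orbT.
by rewrite big_split /= addrK.
Qed.

Lemma cintegral_dirac_sum (h : nat -> R[i]) :
  cintegral dirac_sum h = \sum_(k < n) h k.
Proof.
rewrite /cintegral !Rintegral_dirac_sum.
by elim/big_rec3 : _ => //= k [x y] a b _ []; case: (h k) => p q -> ->.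
Qed.

End Discrete.

(** psi (a, b) is the sum over the distinct points s of the first finite set of
    1_(a = s) psi (s, b). Duplicates are removed from [sA] only so that each s
    is counted once; every psi (s, _) is bounded as its support is finite. *)
Lemma finite_support_in_Psi (R : realType) (psi : R -> R -> R[i])
    (sA sB : seq R) :
  (forall a b, psi a b != 0 -> (a \in sA) && (b \in sB)) -> in_Psi psi.
Proof.
move=> psi0; pose s := undup sA.
pose fA k (a : R) : R[i] := (a == nth 0 s k)%:R.
pose fB k b := psi (nth 0 s k) b.
apply: inhabits.
apply: (@PsiRep R psi _ nat (dirac_sum R (size s)) fA fB).
- move=> k; exists 1 => a; rewrite /fA.
  by case: eqP => _; rewrite ?Normc.normc1 ?Normc.normc0.
- move=> k; exists (\sum_(b <- undup sB) Normc.normc (fB k b)) => b.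
  have [|nb] := boolP (b \in sB).
    rewrite -mem_undup => bs; rewrite (bigD1_seq b) ?undup_uniq //= lerDl.
    by apply: sumr_ge0 => x _; exact: normc_ge0.
  rewrite (_ : fB k b = 0) ?Normc.normc0.
    by apply: sumr_ge0 => x _; exact: normc_ge0.
  by apply/eqP/negPn/negP => /psi0 /andP[_]; exact/negP.
- by move=> a b; split.
- exact: integrable_dirac_sum.
move=> a b; rewrite cintegral_dirac_sum.
rewrite -(big_mkord xpredT (fun k => fA k a * fB k b)).
rewrite -(big_nth 0 xpredT (fun x => (a == x)%:R * psi x b)).
have [as_|nas] := boolP (a \in s).
  rewrite (bigD1_seq a) ?undup_uniq //= eqxx mul1r big1 ?addr0 // => x.
  by rewrite eq_sym => /negPf ->; rewrite mul0r.
rewrite big_seq big1; last first.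
  move=> x xs; case: eqP => [ax|_]; last by rewrite mul0r.
  by move: xs; rewrite -ax (negPf nas).
by apply/eqP/negPn/negP => /psi0 /andP[]; rewrite -mem_undup (negPf nas).
Qed.

(** * Double tensor integrals as Schur multipliers *)

(** Each entry of the integrand is a finite combination of the products
    f_A (a_k) f_B (b_l), with coefficients that do not depend on the integration
    variable; integrating it turns each product into psi (a_k, b_l). *)
Lemma coord_pdti (R : realType) N (I : 'I_N -> nat) (EA EB : tensor R I I)
    (eA eB : eigen_data R I) (psi : R -> R -> R[i]) (r : Psi_rep psi)
    (X : tensor R I I) :
  eigen_decomposition EA eA -> eigen_decomposition EB eB ->
  forall i j, spectral_coord eA eB (pdti EA EB r X) i j =
    psi (eA.1 i) (eB.1 j) * spectral_coord eA eB X i j.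
Proof.
move=> eAP eBP i j.
pose M : 'M[R[i]]_(tdim I) := \matrix_(k, l)
  (psi (eA.1 k) (eB.1 l) * spectral_coord eA eB X k l).
have sandwich (Y : 'M[R[i]]_(tdim I)) a b :
  (eigen_mx eA *m Y *m adjmx (eigen_mx eB)) a b =
  \sum_(kl : 'I_(tdim I) * 'I_(tdim I))
    (eigen_mx eA a kl.1 * conjc (eigen_mx eB b kl.2)) * Y kl.1 kl.2.
  rewrite -(pair_bigA _ (fun k l =>
    eigen_mx eA a k * conjc (eigen_mx eB b l) * Y k l)).
  rewrite exchange_big mxE; apply: eq_bigr => l _.
  rewrite [X in X * _]mxE mulr_suml; apply: eq_bigr => k _.
  by rewrite [adjmx _ _ _]mxE [X in conjc X]mxE mulrAC.
suff tE : tensor_mx (pdti EA EB r X) = eigen_mx eA *m M *m adjmx (eigen_mx eB).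
  rewrite /spectral_coord tE !mulmxA (eigen_mx_isometry eAP.1) mul1mx.
  by rewrite -mulmxA (eigen_mx_isometry eBP.1) mulmx1 mxE.
apply/matrixP => a b; rewrite sandwich mxE ffunE.
have FE s : (tfun (@rep_fA _ _ r s) EA *E X *E tfun (@rep_fB _ _ r s) EB)
    (enum_val a, enum_val b) = \sum_(kl : 'I_(tdim I) * 'I_(tdim I))
    (eigen_mx eA a kl.1 * conjc (eigen_mx eB b kl.2) *
       spectral_coord eA eB X kl.1 kl.2) *
    (@rep_fA _ _ r s (eA.1 kl.1) * @rep_fB _ _ r s (eB.1 kl.2)).
  transitivity (tensor_mx
    (tfun (@rep_fA _ _ r s) EA *E X *E tfun (@rep_fB _ _ r s) EB) a b).
    by rewrite mxE.
  rewrite (tensor_mx_coord eAP eBP) sandwich; apply: eq_bigr => -[k l] _ /=.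
  rewrite (spectral_coord_mulr _ eBP _ (tensor_mx_tfun (@rep_fB _ _ r s) eBP)).
  rewrite (spectral_coord_mull _ eAP _ (tensor_mx_tfun (@rep_fA _ _ r s) eAP)).
  by ring.
transitivity (cintegral (rep_mu r) (fun s =>
    \sum_(kl : 'I_(tdim I) * 'I_(tdim I))
    (eigen_mx eA a kl.1 * conjc (eigen_mx eB b kl.2) *
       spectral_coord eA eB X kl.1 kl.2) *
    (@rep_fA _ _ r s (eA.1 kl.1) * @rep_fB _ _ r s (eB.1 kl.2)))).
  by congr cintegral; apply/funext => s; exact: FE.
rewrite cintegral_sum; last by move=> kl; exact: rep_cintegrable.
apply: eq_bigr => -[k l] _ /=; rewrite -(rep_eq r) [M _ _]mxE; ring.
Qed.

(** * The perturbation formula *)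

Lemma coord_sandwich (R : realType) N (I : 'I_N -> nat) (EA EB : tensor R I I)
    (eA eB : eigen_data R I) (X P F G Q : tensor R I I)
    (p f g q : 'I_(tdim I) -> R[i]) :
  eigen_decomposition EA eA -> eigen_decomposition EB eB ->
  tensor_mx P = eigen_mx eA *m diag_mx (\row_i p i) *m adjmx (eigen_mx eA) ->
  tensor_mx F = eigen_mx eA *m diag_mx (\row_i f i) *m adjmx (eigen_mx eA) ->
  tensor_mx G = eigen_mx eB *m diag_mx (\row_i g i) *m adjmx (eigen_mx eB) ->
  tensor_mx Q = eigen_mx eB *m diag_mx (\row_i q i) *m adjmx (eigen_mx eB) ->
  forall i j, spectral_coord eA eB (P *E (F *E X - X *E G) *E Q) i j =
    p i * ((f i - g j) * spectral_coord eA eB X i j) * q j.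
Proof.
move=> eAP eBP PE FE GE QE i j.
rewrite (spectral_coord_mulr eA eBP _ QE) (spectral_coord_mull eB eAP _ PE).
rewrite spectral_coordB [X in p i * X * _]mxE [X in _ + X]mxE.
rewrite (spectral_coord_mull eB eAP _ FE) (spectral_coord_mulr eA eBP _ GE).
by rewrite mulrBl [_ * g j]mulrC.
Qed.

(** Where a^kA = b^kB both sides vanish, so the values [q] on the diagonal are
    arbitrary. *)
Lemma psi_fun_quotient (R : realType) (f gA gB hA hB : R -> R)
    (mA nA kA mB nB kB : nat) (q : R -> R -> R[i]) (SA SB : set R)
    (a b : R) (x : R[i]) :
  a \in SA -> b \in SB -> gA (a ^+ mA) != 0 -> gB (b ^+ mB) != 0 ->
  psi_fun f gA gB hA hB mA nA kA mB nB kB q SA SB a b *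
    ((gA (a ^+ mA))%:C * (((a ^+ kA)%:C - (b ^+ kB)%:C) * x) *
     (gB (b ^+ mB))%:C) =
  (hA (a ^+ nA))%:C * (((f (a ^+ kA))%:C - (f (b ^+ kB))%:C) * x) *
    (hB (b ^+ nB))%:C.
Proof.
move=> aSA bSB gA0 gB0; rewrite /psi_fun aSA bSB /= /diff_quotient.
case: eqP => [->|/eqP]; first by rewrite !subrr !(mul0r, mulr0).
rewrite -subr_eq0 => ab0.
have C0 (y : R) : (y%:C != 0) = (y != 0) by rewrite (inj_eq (@complexI R)).
rewrite !rmorphM !fmorphV !rmorphB /=; field.
by rewrite -rmorphB !C0 gA0 gB0 ab0.
Qed.

Theorem theorem2 (R : realType) (N : nat) (I : 'I_N -> nat)
    (f gA gB hA hB : R -> R) (EA EB : tensor R I I)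
    (mA nA kA mB nB kB : nat) (q : R -> R -> R[i])
    (f_bounded : bounded_real f)
    (gA_bounded : bounded_real gA) (gB_bounded : bounded_real gB)
    (hA_bounded : bounded_real hA) (hB_bounded : bounded_real hB)
    (EA_herm : hermitian_tensor EA) (EB_herm : hermitian_tensor EB)
    (gA_neq0 : forall a : R, teigenvalues EA a -> gA (a ^+ mA) != 0)
    (gB_neq0 : forall b : R, teigenvalues EB b -> gB (b ^+ mB) != 0) :
  let psi := psi_fun f gA gB hA hB mA nA kA mB nB kB q
               (teigenvalues EA) (teigenvalues EB) in
  let GA := tfun_real gA (tpow EA mA) in
  let GB := tfun_real gB (tpow EB mB) in
  let HA := tfun_real hA (tpow EA nA) in
  let HB := tfun_real hB (tpow EB nB) in
  let FA := tfun_real f (tpow EA kA) in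
  let FB := tfun_real f (tpow EB kB) in
  in_Psi psi /\
  forall X : tensor R I I,
    let lhs := HA *E (FA *E X - X *E FB) *E HB in
    let rhs := GA *E (tpow EA kA *E X - X *E tpow EB kB) *E GB in
    (forall r : Psi_rep psi, lhs = pdti EA EB r rhs) /\
    ((tnorm lhs)%:E <=
       ((tdim I ^ 2)%N%:R)%:E * Psi_norm psi * (tnorm rhs)%:E)%E.
Proof.
move=> psi GA GB HA HB FA FB.
have [eA eAP] := hermitian_eigen_decomposition EA_herm.
have [eB eBP] := hermitian_eigen_decomposition EB_herm.
(* Eigenvalues of Hermitian tensors form a finite set, hence so does the
   support of psi. *)
have psi_in : in_Psi psi.
  apply: (@finite_support_in_Psi _ _ (codom eA.1) (codom eB.1)) => a b.
  rewrite /psi /psi_fun; case: ifP => [|_]; last by rewrite eqxx.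
  move=> /andP[/set_mem/(teigenvaluesP _ eAP)[i ->]].
  move=> /set_mem/(teigenvaluesP _ eBP)[j ->] _.
  by rewrite !codom_f.
split=> // X lhs rhs.
have lhsE i j : spectral_coord eA eB lhs i j =
    psi (eA.1 i) (eB.1 j) * spectral_coord eA eB rhs i j.
  have spA : teigenvalues EA (eA.1 i) by apply/(teigenvaluesP _ eAP); exists i.
  have spB : teigenvalues EB (eB.1 j) by apply/(teigenvaluesP _ eBP); exists j.
  rewrite /lhs /rhs.
  rewrite (coord_sandwich X eAP eBP (tensor_mx_tfun_pow hA nA eAP)
    (tensor_mx_tfun_pow f kA eAP) (tensor_mx_tfun_pow f kB eBP)
    (tensor_mx_tfun_pow hB nB eBP)).
  rewrite (coord_sandwich X eAP eBP (tensor_mx_tfun_pow gA mA eAP)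
    (tensor_mx_pow kA eAP) (tensor_mx_pow kB eBP)
    (tensor_mx_tfun_pow gB mB eBP)).
  by rewrite psi_fun_quotient ?mem_set //; [exact: gA_neq0|exact: gB_neq0].
split=> [r|].
  apply: (spectral_coord_inj eAP eBP); apply/matrixP => i j.
  by rewrite (coord_pdti r rhs eAP eBP).
have [p pE] : exists p : R, Psi_norm psi = p%:E.
  by exists (fine (Psi_norm psi)); rewrite fineK // Psi_norm_fin_num.
have psi_p a b : Normc.normc (psi a b) <= p.
  by rewrite -lee_fin -pE; exact: normc_le_Psi_norm.
have p0 : 0 <= p := le_trans (normc_ge0 _) (psi_p 0 0).
rewrite pE -!EFinM lee_fin -ler_sqr ?nnegrE ?mulr_ge0 ?tnorm_ge0 ?ler0n //.
(* ||lhs||^2 <= ||lhs||_F^2 <= p^2 ||rhs||_F^2 <= p^2 D ||rhs||^2 *)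
apply: le_trans (tnorm_le_frobenius lhs) _.
apply: le_trans (_ : p ^+ 2 * frobenius2 (tensor_mx rhs) <= _).
  rewrite -(frobenius2_coord eAP eBP) -(frobenius2_coord eAP eBP rhs).
  rewrite /frobenius2 mulr_sumr; apply: ler_sum => i _.
  rewrite mulr_sumr; apply: ler_sum => j _.
  rewrite lhsE Normc.normcM exprMn; apply: ler_wpM2r; first exact: sqr_ge0.
  by rewrite ler_sqr ?nnegrE ?normc_ge0.
rewrite !exprMn (mulrC _ (p ^+ 2)) -[leRHS]mulrA ler_wpM2l ?sqr_ge0 //.
apply: le_trans (frobenius_le_tnorm rhs) _; rewrite ler_wpM2r ?sqr_ge0 //.
rewrite -natrX ler_nat -expnM.
by case: (tdim I) => // d; rewrite -{1}[d.+1]expn1 leq_pexp2l.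
Qed.
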